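(* For all integers $k\ge 1$ and $n\ge 2$, the generating function for the Betti numbers of the path ideal $I_{k,n}$ satisfies $$G_{k,n}(x,t)=\bigl(1+t\,G_{k,n-1}(x,t)\bigr)^k-1 .$$
   Context: $T_{k,n}$ is the complete $k$-ary rooted tree of depth $n$: every non-leaf node has exactly $k$ children and all leaves are at distance $n$ from the root. Let $K$ be a field and let $S_{k,n}=K[x_e: e\in E(T_{k,n})]$ be the standard graded polynomial ring with one variable per edge. The path ideal $I_{k,n}\subset S_{k,n}$ is generated by the $k^n$ monomials $\prod_{e\in P}x_e$, where $P$ runs over the edge sets of the paths from the root to each leaf. With graded Betti numbers $\beta_{i,j}(M)=\dim_K\mathrm{Tor}_i^{S_{k,n}}(M,K)_j$, set $$G_{k,n}(x,t)=\sum_{i,j>0}\beta_{i,j}(S_{k,n}/I_{k,n})\,x^i t^j .$$ (In particular $G_{k,1}(x,t)=(1+tx)^k-1$.) *)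

(* Defs.v *)
From mathcomp Require Import all_boot all_order all_algebra.
From mathcomp Require Import boolp classical_sets functions cardinality fsbigop.
From mathcomp Require Import mpoly.

Set Implicit Arguments.
Unset Strict Implicit.
Unset Printing Implicit Defensive.

Import GRing.Theory.
Local Open Scope ring_scope.

(* Vertices of T_{k,n} are the words of length at most n over a k-letter
   alphabet; the root is the empty word, and the children of a word are its
   one-letter extensions. *)
Definition vertex (k n : nat) : finType := {bseq n of 'I_k}.

Definition root_vertex (k n : nat) : vertex k n := [bseq].

Definition child (k n : nat) (v w : vertex k n) : bool :=
  [exists a : 'I_k, (w : seq 'I_k) == rcons (v : seq 'I_k) a].

Definition leaf (k n : nat) (v : vertex k n) : bool :=
  [forall w : vertex k n, ~~ child v w].

Definition edge (k n : nat) : finType :=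
  {vw : vertex k n * vertex k n | child vw.1 vw.2}.

Definition path_edges (k n : nat) (p : seq (vertex k n)) : {set edge k n} :=
  [set e : edge k n | val e \in zip (root_vertex k n :: p) p]%SET.

Definition root_leaf_path (k n : nat) (P : {set edge k n}) : Prop :=
  exists p : seq (vertex k n),
    [/\ path (@child k n) (root_vertex k n) p,
        leaf (last (root_vertex k n) p) & P = path_edges p].

Definition ideal_span (R : comNzRingType) (A : set R) : set R :=
  fun p => exists s : seq (R * R),
    (forall u, u \in s -> A u.2) /\ p = \sum_(u <- s) u.1 * u.2.

(* The variable x_e is 'X_(enum_rank e). *)
Definition path_ideal (K : fieldType) (k n : nat) :
    set {mpoly K[#|edge k n|]} :=
  ideal_span (fun f => exists P : {set edge k n},
    root_leaf_path P /\ f = \prod_(e in P) 'X_(enum_rank e)).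

(* A sequence of graded free S-modules F_i of finite rank over
   S = K[x_0, .., x_(N-1)]: gen_deg i u is the degree of the u-th basis element
   of F_i, and maps act on row vectors on the right.  The map F_0 -> S/I is
   given by representatives in S of the images of the basis elements. *)
Record graded_free (K : fieldType) (N : nat) := GradedFree {
  rk : nat -> nat;
  gen_deg : forall i : nat, 'I_(rk i) -> nat;
  diff : forall i : nat, 'M[{mpoly K[N]}]_(rk i.+1, rk i);
  aug : 'cV[{mpoly K[N]}]_(rk 0) }.

Definition is_resolution (K : fieldType) (N : nat)
    (I : set {mpoly K[N]}) (F : graded_free K N) : Prop :=
  [/\ forall (i : nat) (u : 'I_(rk F i.+1)) (v : 'I_(rk F i)),
        if (gen_deg v <= gen_deg u)%N
        then diff F i u v \is (gen_deg u - gen_deg v)%N.-homog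
        else diff F i u v == 0,
      forall u : 'I_(rk F 0), aug F u 0 \is (gen_deg u).-homog,
      forall p : {mpoly K[N]},
        exists v : 'rV_(rk F 0), I (p - (v *m aug F) 0 0),
      forall v : 'rV_(rk F 0),
        I ((v *m aug F) 0 0) <-> exists w, v = w *m diff F 0
    & forall (i : nat) (v : 'rV_(rk F i.+1)),
        v *m diff F i = 0 <-> exists w, v = w *m diff F i.+1 ].

(* F_i (x)_S K = K^(rk F i), where K = S/(x_0, .., x_(N-1)): the entries of the
   differentials are reduced to their constant coefficients. *)
Definition tdiff (K : fieldType) (N : nat) (F : graded_free K N) (i : nat) :
    'M[K]_(rk F i.+1, rk F i) :=
  map_mx (fun p : {mpoly K[N]} => p@_0%MM) (diff F i).

Definition tgraded (K : fieldType) (N : nat) (F : graded_free K N)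
    (i j : nat) : 'M[K]_(rk F i) :=
  diag_mx (\row_(u < rk F i) (gen_deg u == j)%:R).

Definition tcycles (K : fieldType) (N : nat) (F : graded_free K N) (i : nat) :
    'M[K]_(rk F i) :=
  match i with
  | 0 => 1%:M
  | i'.+1 => kermx (tdiff F i')
  end.

(* dim_K H_i(F (x)_S K)_j *)
Definition tor_dim (K : fieldType) (N : nat) (F : graded_free K N)
    (i j : nat) : nat :=
  \rank (tgraded F i j :&: tcycles F i)%MS
    - \rank (tgraded F i.+1 j *m tdiff F i).

(* beta_{i,j}(S/I) = dim_K Tor_i^S(S/I, K)_j, computed from any graded free
   resolution of S/I.  For a homogeneous ideal such resolutions exist and all
   give the same value, so that xget selects from a singleton. *)
Definition betti (K : fieldType) (N : nat) (I : set {mpoly K[N]})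
    (i j : nat) : nat :=
  xget 0%N (fun b => exists2 F : graded_free K N,
    is_resolution I F & b = tor_dim F i j).

(* Z[x][t] *)
Definition var_x : {poly {poly int}} := ('X)%:P.
Definition var_t : {poly {poly int}} := 'X.

(* A finitely supported sum, since S/I has a finite graded free resolution. *)
Definition betti_gf (K : fieldType) (k n : nat) : {poly {poly int}} :=
  \sum_(ij \in [set ij : nat * nat | (0 < ij.1)%N && (0 < ij.2)%N])
     ((betti (@path_ideal K k n) ij.1 ij.2)%:R * var_x ^+ ij.1 * var_t ^+ ij.2).

(* Main.v *)
Require Import Defs.
From mathcomp Require Import all_boot all_order all_algebra.
From mathcomp Require Import boolp classical_sets fsbigop mpoly.
Set Implicit Arguments.
Unset Strict Implicit.
Unset Printing Implicit Defensive.
Import GRing.Theory.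
Local Open Scope ring_scope.

(** The Taylor complex of the path ideal is its minimal free resolution.

    The generators of I_{k,n} are indexed by the words w of length n, that is,
    by the leaves.  Every monomial ideal is resolved by its Taylor complex,
    which has one basis element for each set L of generators, in homological
    degree |L| and in internal degree the degree of the least common multiple
    of L ([taylor_resolution]).  In each multidegree M it is the augmented
    chain complex of the full simplex on the generators dividing M, hence
    contractible as soon as one generator divides M ([boundary_contract]).
    A path from the root to a leaf has an edge which lies on no other such
    path, namely the last one; so adding a generator to L always enlarges the
    lcm ([path_monomial_minimal]), no entry of a differential is a nonzero
    constant, and the Betti numbers count the basis elements
    ([betti_taylor]).  As a Betti number is read off from some resolution,
    this relies on the comparison theorem: any two graded resolutions of a
    homogeneous ideal give the same dimensions ([tor_dim_le]).

    Therefore 1 + G_{k,n} is the sum of x^|L| t^e(L) over all sets L of words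
    of length n, where e(L) is the number of edges of the subtree spanned by
    the leaves in L, i.e. the number of nonempty prefixes of words in L
    ([betti_gfE]).  Such a set L is an arbitrary k-tuple of sets L_a of words
    of length n - 1, one below each child a of the root, and each nonempty
    L_a contributes its own edges plus the edge from the root to a.  Hence
    the sum for n is the k-th power of
      1 + sum over nonempty L' of x^|L'| t^(e(L') + 1) = 1 + t G_{k,n-1}
    ([path_set_gf_rec]). *)

(** * Homology of homotopy retracts *)

(** In each pair, C is a space of cycles and B a space of boundaries.  If f
    and g induce maps between the homologies C/B with g after f equal to the
    identity, then f is injective on homology. *)
Lemma homology_rank_le (K : fieldType) (a b r1 r2 r3 r4 : nat)
    (CF : 'M[K]_(r1, a)) (BF : 'M_(r2, a)) (CG : 'M_(r3, b)) (BG : 'M_(r4, b))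
    (f : 'M_(a, b)) (g : 'M_(b, a)) :
  (CF *m f <= CG)%MS -> (BG *m g <= BF)%MS -> (BG <= CG)%MS ->
  (CF *m (f *m g - 1%:M) <= BF)%MS ->
  (\rank CF - \rank BF <= \rank CG - \rank BG)%N.
Proof.
move=> fC gB sBC homot.
have rF := mxrank_mul_ker CF (f *m cokermx BG).
have rG := mxrank_mul_ker CG (cokermx BG).
have ker_le : (CF :&: kermx (f *m cokermx BG) <= BF)%MS.
  apply/rV_subP => v; rewrite sub_capmx => /andP [vCF].
  move/sub_kermxP; rewrite mulmxA => vf0.
  have vfBG : (v *m f <= BG)%MS by rewrite submxE vf0.
  have vfg : (v *m f *m g <= BF)%MS.
    by apply: submx_trans gB; apply: submxMr.
  have vh : (v *m (f *m g - 1%:M) <= BF)%MS.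
    by apply: submx_trans homot; apply: submxMr.
  have -> : v = v *m f *m g - v *m (f *m g - 1%:M).
    by rewrite mulmxBr mulmx1 mulmxA opprB addrC subrK.
  by apply: addmx_sub => //; rewrite eqmx_opp.
have BG_le : (BG <= CG :&: kermx (cokermx BG))%MS.
  by rewrite sub_capmx sBC; apply/sub_kermxP; apply: mulmx_coker.
have im_le : (\rank (CF *m (f *m cokermx BG)) <= \rank (CG *m cokermx BG))%N.
  by apply: mxrankS; rewrite mulmxA; apply: submxMr.
move: (mxrankS ker_le) (mxrankS BG_le) => h1 h2.
apply: leq_trans (leq_trans im_le _).
  by rewrite leq_subLR -rF addnC leq_add2r.
by rewrite -[X in (X <= _)%N](addnK (\rank (CG :&: kermx (cokermx BG)))) rG leq_sub2l.
Qed.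

(** * Matrices of homogeneous maps between graded free modules *)

Lemma pihomog_mulr (K : fieldType) (N d e : nat) (p q : {mpoly K[N]}) :
  q \is e.-homog ->
  pihomog mdeg d (p * q) =
    if (e <= d)%N then pihomog mdeg (d - e) p * q else 0.
Proof.
move=> hq.
have dec := pihomog_partitionE (mf := @mdeg N) (leqnn (mmeasure (@mdeg N) p)).
rewrite [in LHS]dec [in RHS]dec.
rewrite mulr_suml !raddf_sum /=.
have E k : pihomog mdeg d (pihomog mdeg k p * q) =
    if (e <= d)%N then pihomog mdeg (d - e) (pihomog mdeg k p) * q else 0.
  have hk := pihomogP (@mdeg N) k p.
  have hkq := dhomogM hk hq.
  have [ed|de] := leqP e d.
    have [kd|kd] := eqVneq k (d - e)%N.
      by rewrite -kd pihomog_id pihomog_dE // -(subnK ed) -kd.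
    rewrite (pihomog_ne0 kd hk) mul0r (pihomog_ne0 _ hkq) //.
    by apply: contraNneq kd => <-; rewrite addnK.
  rewrite (pihomog_ne0 _ hkq) //.
  by apply: contraTneq de => <-; rewrite -leqNgt leq_addl.
under eq_bigr => k _ do rewrite E.
by case: leqP => _; [rewrite mulr_suml | rewrite big1].
Qed.

Section GradedMatrices.
Variables (K : fieldType) (N : nat).
Local Notation S := {mpoly K[N]}.

Definition homog_mx a b (da : 'I_a -> nat) (db : 'I_b -> nat)
    (A : 'M[S]_(a, b)) : Prop :=
  forall u v, if (db v <= da u)%N then A u v \is (da u - db v)%N.-homog
              else A u v == 0.

(** The degree-preserving part of a map: it turns an arbitrary solution of a
    linear equation with homogeneous data into a homogeneous one. *)
Definition homog_part a b (da : 'I_a -> nat) (db : 'I_b -> nat)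
    (A : 'M[S]_(a, b)) : 'M[S]_(a, b) :=
  \matrix_(u, v) if (db v <= da u)%N
                 then pihomog mdeg (da u - db v)%N (A u v) else 0.

Lemma homog_partP a b da db (A : 'M_(a, b)) :
  homog_mx da db (homog_part da db A).
Proof. by move=> u v; rewrite mxE; case: (db v <= da u)%N => //=; apply: pihomogP.
Qed.

Lemma homog_part_id a b da db (A : 'M_(a, b)) :
  homog_mx da db A -> homog_part da db A = A.
Proof.
move=> hA; apply/matrixP => u v; rewrite mxE; move: (hA u v).
by case: ifP => _ => [/pihomog_dE|/eqP].
Qed.

Lemma homog_partM a b c da db dc (A : 'M_(a, b)) (B : 'M_(b, c)) :
  homog_mx db dc B ->
  homog_part da dc (A *m B) = homog_part da db A *m B.
Proof.
move=> hB; apply/matrixP => u w; rewrite !mxE raddf_sum /=.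
under [RHS]eq_bigr => v _ do rewrite mxE.
case: ifP => [wu|wu]; last first.
  rewrite big1 // => v _; move: (hB v w).
  case: ifP => [wv _|_ /eqP ->]; last by rewrite mulr0.
  rewrite ifF ?mul0r //; apply: contraFF wu => vu; exact: leq_trans wv vu.
apply: eq_bigr => v _; move: (hB v w).
case: ifP => [wv hBvw|_ /eqP ->]; last by rewrite !mulr0 raddf0.
rewrite (pihomog_mulr _ _ hBvw) leq_sub2rE //.
by case: ifP => vu; rewrite ?mul0r // subnBA // subnK.
Qed.

Lemma homog_mxM a b c da db dc (A : 'M_(a, b)) (B : 'M_(b, c)) :
  homog_mx da db A -> homog_mx db dc B -> homog_mx da dc (A *m B).
Proof.
move=> hA hB; rewrite -(homog_part_id hA) -(homog_partM _ _ hB).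
exact: homog_partP.
Qed.

(** The functor of tensoring with K over S, on matrices. *)
Definition red_mx a b (A : 'M[S]_(a, b)) : 'M[K]_(a, b) :=
  map_mx (mcoeff 0%MM) A.

(** The projection onto the degree j part of the reduced graded module. *)
Definition degree_mx a (da : 'I_a -> nat) (j : nat) : 'M[K]_a :=
  diag_mx (\row_u (da u == j)%:R).

Lemma red_mxM a b c (A : 'M_(a, b)) (B : 'M_(b, c)) :
  red_mx (A *m B) = red_mx A *m red_mx B.
Proof. exact: map_mxM. Qed.

Lemma red_mxB a b (A B : 'M_(a, b)) :
  red_mx (A - B) = red_mx A - red_mx B.
Proof. exact: map_mxB. Qed.

Lemma red_mx1 a : red_mx 1%:M = 1%:M :> 'M_a.
Proof. exact: map_mx1. Qed.

Lemma mcoeff0_homog d (p : S) : (0 < d)%N -> p \is d.-homog -> p@_0%MM = 0.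
Proof.
move=> d_gt0 /dhomogP hp; apply/eqP; apply: contraLR d_gt0.
by rewrite -mcoeff_msupp => /hp <- /=; rewrite mdeg0.
Qed.

Lemma degree_mx_red a b da db (A : 'M_(a, b)) j :
  homog_mx da db A ->
  degree_mx da j *m red_mx A = red_mx A *m degree_mx db j.
Proof.
move=> hA; apply/matrixP => u v.
rewrite mul_diag_mx mul_mx_diag !mxE mulrC; move: (hA u v).
have [->//|duv] := eqVneq (da u) (db v).
case: ifP => [le hAuv|_ /eqP ->]; last by rewrite mcoeff0 !mul0r.
by rewrite (mcoeff0_homog _ hAuv) ?mul0r // subn_gt0 ltn_neqAle eq_sym duv.
Qed.

Lemma degree_mx_idem a (da : 'I_a -> nat) j :
  degree_mx da j *m degree_mx da j = degree_mx da j.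
Proof.
apply/matrixP => u v; rewrite mul_diag_mx !mxE.
by case: eqP => _; rewrite ?mul1r ?mul0r ?mul0rn.
Qed.

Lemma degree_mx_sub a r (da : 'I_a -> nat) j (C : 'M_(r, a)) :
  (C <= degree_mx da j)%MS -> C *m degree_mx da j = C.
Proof. by move/submxP => [D ->]; rewrite -mulmxA degree_mx_idem. Qed.

End GradedMatrices.

Lemma rank_degree_mx (K : fieldType) a (da : 'I_a -> nat) j :
  \rank (degree_mx K da j) = #|[set u | da u == j]%SET|.
Proof.
have -> : \rank (degree_mx K da j) =
    \rank (\sum_(u | da u == j) <<delta_mx 0 u : 'rV[K]_a>>)%MS.
  apply: eqmx_rank; apply/andP; split.
    apply/row_subP => u; rewrite row_diag_mx mxE.
    case: eqP => [/eqP ju|_]; last by rewrite scale0r sub0mx.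
    by rewrite scale1r (sumsmx_sup u) // genmxE.
  apply/sumsmx_subP => u ju; rewrite genmxE.
  suff -> : delta_mx 0 u = row u (degree_mx K da j) by apply: row_sub.
  by rewrite row_diag_mx mxE ju scale1r.
have /mxdirectP -> := mxdirect_delta K (P := fun u => da u == j) (in2W (@inj_id _)).
rewrite /= -sum1_card; apply: eq_big => [u|u _]; first by rewrite inE.
by rewrite genmxE mxrank_delta.
Qed.

(** * Independence of the Betti numbers from the resolution *)

Section Comparison.
Variables (K : fieldType) (N : nat) (I : set {mpoly K[N]}).
Local Notation S := {mpoly K[N]}.
Hypotheses (I0 : I 0) (ID : forall p q, I p -> I q -> I (p + q)).
Hypotheses (IM : forall p q, I q -> I (p * q)).
Hypothesis (Ihomog : forall d p, I p -> I (pihomog mdeg d p)).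

Lemma row_lift a b c (X : 'M[S]_(a, c)) (D : 'M[S]_(b, c)) :
  (forall u, exists y, row u X = y *m D) -> exists Y, X = Y *m D.
Proof.
move/fin_all_exists => [y hy]; exists (\matrix_u y u).
by apply/row_matrixP => u; rewrite row_mul rowK hy.
Qed.

Lemma homog_lift a b c da db dc (X : 'M[S]_(a, c)) (D : 'M[S]_(b, c)) :
  homog_mx da dc X -> homog_mx db dc D ->
  (exists Y, X = Y *m D) -> exists2 Y, homog_mx da db Y & X = Y *m D.
Proof.
move=> hX hD [Y XE]; exists (homog_part da db Y); first exact: homog_partP.
by rewrite -(homog_partM _ _ hD) -XE homog_part_id.
Qed.

Definition all_in a b (A : 'M[S]_(a, b)) := forall u v, I (A u v).

Lemma I_sum (J : finType) (F : J -> S) :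
  (forall j, I (F j)) -> I (\sum_j F j).
Proof. by move=> h; apply: (big_ind I). Qed.

Lemma all_inM a b c (A : 'M_(a, b)) (B : 'M_(b, c)) :
  all_in B -> all_in (A *m B).
Proof. by move=> hB u v; rewrite mxE; apply: I_sum => w; apply: IM. Qed.

Lemma all_inB a b (A B : 'M_(a, b)) : all_in A -> all_in B -> all_in (A - B).
Proof.
move=> hA hB u v; rewrite !mxE -mulN1r; apply: ID => //.
exact: IM.
Qed.

Section Resolution.
Variables (F : graded_free K N) (resF : is_resolution I F).

Lemma diff_homog i : homog_mx (@gen_deg _ _ F i.+1) (@gen_deg _ _ F i) (diff F i).
Proof. by move=> u v; case: resF => /(_ i u v). Qed.

Lemma aug_homog : homog_mx (@gen_deg _ _ F 0) (fun=> 0%N) (aug F).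
Proof. by move=> u v; rewrite leq0n subn0 ord1; case: resF. Qed.

Lemma diffM i : diff F i.+1 *m diff F i = 0.
Proof.
apply/row_matrixP => u; rewrite row0 row_mul.
case: resF => _ _ _ _ /(_ i (row u (diff F i.+1))) [_ h]; apply: h.
by exists (delta_mx 0 u); rewrite rowE.
Qed.

Lemma diff_aug : all_in (diff F 0 *m aug F).
Proof.
move=> u v; rewrite ord1.
have -> : (diff F 0 *m aug F) u 0 = (row u (diff F 0) *m aug F) 0 0.
  by rewrite -row_mul [RHS]mxE.
case: resF => _ _ _ /(_ (row u (diff F 0))) [_ h] _; apply: h.
by exists (delta_mx 0 u); rewrite rowE.
Qed.

Lemma lift_diff a i (X : 'M_(a, _)) : X *m diff F i = 0 ->
  exists Y, X = Y *m diff F i.+1.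
Proof.
move=> X0; apply: row_lift => u; case: resF => _ _ _ _ /(_ i (row u X)) [h _].
by apply: h; rewrite -row_mul X0 row0.
Qed.

Lemma lift_diff0 a (X : 'M_(a, _)) : all_in (X *m aug F) ->
  exists Y, X = Y *m diff F 0.
Proof.
move=> XI; apply: row_lift => u; case: resF => _ _ _ /(_ (row u X)) [h _] _.
by apply: h; rewrite -row_mul mxE; apply: XI.
Qed.

Lemma lift_diff_homog a da i (X : 'M_(a, _)) :
  homog_mx da (@gen_deg _ _ F i.+1) X -> X *m diff F i = 0 ->
  exists2 Y, homog_mx da (@gen_deg _ _ F i.+2) Y & X = Y *m diff F i.+1.
Proof.
by move=> hX X0; apply: homog_lift (lift_diff X0) => //; apply: diff_homog.
Qed.

Lemma lift_diff0_homog a da (X : 'M_(a, _)) :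
  homog_mx da (@gen_deg _ _ F 0) X -> all_in (X *m aug F) ->
  exists2 Y, homog_mx da (@gen_deg _ _ F 1) Y & X = Y *m diff F 0.
Proof.
by move=> hX X0; apply: homog_lift (lift_diff0 X0) => //; apply: diff_homog.
Qed.

(** This is where the ideal must be homogeneous: the degree-preserving part
    of a congruence modulo the ideal is again a congruence. *)
Lemma lift_aug a da (c : 'cV_a) : homog_mx da (fun=> 0%N) c ->
  exists2 Y, homog_mx da (@gen_deg _ _ F 0) Y & all_in (c - Y *m aug F).
Proof.
move=> hc.
have [y hy] : exists y : 'I_a -> 'rV_(rk F 0),
    forall u, I (c u 0 - (y u *m aug F) 0 0).
  apply: (fin_all_exists (P := fun u (y : 'rV_(rk F 0)) =>
    I (c u 0 - (y *m aug F) 0 0))) => u.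
  by case: resF => _ _ h _ _; exact: h.
have hY : all_in (c - (\matrix_u y u) *m aug F).
  move=> u v; rewrite !mxE ord1; move: (hy u); rewrite mxE.
  by under [X in _ -> I (_ - X)]eq_bigr => w _ do rewrite mxE.
exists (homog_part da (@gen_deg _ _ F 0) (\matrix_u y u)); first exact: homog_partP.
rewrite -(homog_partM _ _ aug_homog) -(homog_part_id hc) => u v.
rewrite !mxE leq0n -raddfB /=; apply: Ihomog; move: (hY u v); by rewrite !mxE.
Qed.

End Resolution.

(** The identity of S/I lifts to a morphism of resolutions, one degree after
    the other, because the modules of F are free and G is exact. *)
Lemma chain_map F G (resF : is_resolution I F) (resG : is_resolution I G) :
  exists f : forall i, 'M[S]_(rk F i, rk G i),
  [/\ forall i, homog_mx (@gen_deg _ _ F i) (@gen_deg _ _ G i) (f i),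
      all_in (aug F - f 0%N *m aug G) &
      forall i, diff F i *m f i = f i.+1 *m diff G i].
Proof.
have [f0 hf0 f0aug] := lift_aug resG (aug_homog resF).
have [f1 hf1 f1E] : exists2 f1, homog_mx (@gen_deg _ _ F 1) (@gen_deg _ _ G 1) f1
    & diff F 0 *m f0 = f1 *m diff G 0.
  apply: (lift_diff0_homog resG).
    by apply: homog_mxM hf0; apply: diff_homog.
  rewrite -mulmxA -[f0 *m _](subKr (aug F)) mulmxBr; apply: all_inB.
    exact: diff_aug.
  exact: all_inM.
(* The next component exists because of the relation between the two before
   it, so the recursion carries pairs of consecutive components. *)
pose T i := {p : 'M[S]_(rk F i, rk G i) * 'M[S]_(rk F i.+1, rk G i.+1) |
  [/\ homog_mx (@gen_deg _ _ F i) (@gen_deg _ _ G i) p.1,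
      homog_mx (@gen_deg _ _ F i.+1) (@gen_deg _ _ G i.+1) p.2 &
      diff F i *m p.1 = p.2 *m diff G i]}.
have step i (p : T i) : {q : T i.+1 | (sval q).1 = (sval p).2}.
  case: p => [[a b] /= [ha hb ab]].
  have /cid2 [c hc cE] : exists2 c,
      homog_mx (@gen_deg _ _ F i.+2) (@gen_deg _ _ G i.+2) c
      & diff F i.+1 *m b = c *m diff G i.+1.
    apply: (lift_diff_homog resG).
      by apply: homog_mxM hb; apply: diff_homog.
    by rewrite -mulmxA -ab mulmxA diffM // mul0mx.
  by exists (exist _ (b, c) (And3 hb hc cE)).
pose t := nat_rect T (exist _ (f0, f1) (And3 hf0 hf1 f1E))
  (fun i p => sval (step i p)).
have tS i : (sval (t i.+1)).1 = (sval (t i)).2 by exact: (svalP (step i (t i))).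
exists (fun i => (sval (t i)).1); split=> // i.
  by case: (svalP (t i)).
by rewrite tS; case: (svalP (t i)).
Qed.

(** The homotopy is not required to respect the grading: on cycles of a given
    degree, [tor_dim_le] projects its value to that degree. *)
Lemma null_homotopy F (resF : is_resolution I F)
    (f : forall i, 'M[S]_(rk F i, rk F i)) :
  all_in (f 0%N *m aug F) -> 
  (forall i, diff F i *m f i = f i.+1 *m diff F i) ->
  exists h : forall i, 'M[S]_(rk F i, rk F i.+1),
  f 0%N = h 0%N *m diff F 0 /\ 
  forall i, f i.+1 = h i.+1 *m diff F i.+1 + diff F i *m h i.
Proof.
move=> f0 fE.
have [h0 h0E] := lift_diff0 resF f0.
(* The invariant says that f i - h d vanishes on the boundaries in F_i. *)
pose T i := {h : 'M[S]_(rk F i, rk F i.+1) |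
  diff F i *m f i = diff F i *m h *m diff F i}.
have step i (h : T i) : {h' : T i.+1 |
    f i.+1 = sval h' *m diff F i.+1 + diff F i *m sval h}.
  case: h => h /= hE.
  have /cid [h' h'E] : exists h', f i.+1 - diff F i *m h = h' *m diff F i.+1.
    by apply: (lift_diff resF); rewrite mulmxBl -fE hE subrr.
  have fE' : f i.+1 = h' *m diff F i.+1 + diff F i *m h by rewrite -h'E subrK.
  have h'T : diff F i.+1 *m f i.+1 = diff F i.+1 *m h' *m diff F i.+1.
    by rewrite fE' mulmxDr !mulmxA diffM // mul0mx addr0.
  by exists (exist _ h' h'T).
have h0T : diff F 0 *m f 0%N = diff F 0 *m h0 *m diff F 0.
  by rewrite -mulmxA -h0E.
pose t := nat_rect T (exist _ h0 h0T) (fun i p => sval (step i p)).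
exists (fun i => sval (t i)); split => // i.
exact: (svalP (step i (t i))).
Qed.

Lemma tdiffE (F : graded_free K N) i : tdiff F i = red_mx (diff F i).
Proof. by []. Qed.

Lemma tgradedE (F : graded_free K N) i j :
  tgraded F i j = degree_mx K (@gen_deg _ _ F i) j.
Proof. by []. Qed.

(** Lifts of the identity in both directions have a composite homotopic to the
    identity, so that the homology of F (x) K is a retract of that of
    G (x) K.  The lifts are homogeneous, so this holds in each degree j. *)
Lemma tor_dim_le F G (resF : is_resolution I F) (resG : is_resolution I G) i j :
  (tor_dim F i j <= tor_dim G i j)%N.
Proof.
have [f [hf f0 fE]] := chain_map resF resG.
have [g [hg g0 gE]] := chain_map resG resF.
have [h [h0 hE]] : exists h : forall i, 'M[S]_(rk F i, rk F i.+1),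
    f 0%N *m g 0%N - 1%:M = h 0%N *m diff F 0 /\ 
    forall i, f i.+1 *m g i.+1 - 1%:M
              = h i.+1 *m diff F i.+1 + diff F i *m h i.
  apply: (null_homotopy resF (f := fun i => f i *m g i - 1%:M)) => [|k].
    have -> : (f 0%N *m g 0%N - 1%:M) *m aug F =
       0 - ((aug F - f 0%N *m aug G) + f 0%N *m (aug G - g 0%N *m aug F)).
      by rewrite mulmxBl mulmxBr mul1mx mulmxA addrA subrK add0r opprB.
    apply: all_inB => [u v|]; first by rewrite mxE.
    by move=> u v; rewrite mxE; apply: ID => //; apply: all_inM.
  by rewrite mulmxBr mulmxBl mul1mx mulmx1 mulmxA fE -!mulmxA gE.
apply: (@homology_rank_le _ _ _ _ _ _ _ _ _ _ _ (red_mx (f i)) (red_mx (g i))).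
- rewrite sub_capmx; apply/andP; split.
    apply: submx_trans (submxMr _ (capmxSl _ _)) _.
    by rewrite !tgradedE (degree_mx_red _ (hf i)) submxMl.
  apply: submx_trans (submxMr _ (capmxSr _ _)) _.
  case: i => [|i] /=; first exact: submx1.
  apply/sub_kermxP.
  by rewrite -mulmxA !tdiffE -red_mxM -fE red_mxM mulmxA mulmx_ker mul0mx.
- rewrite -mulmxA !tdiffE -red_mxM gE red_mxM mulmxA tgradedE (degree_mx_red _ (hg i.+1)).
  by rewrite -mulmxA; apply: submxMl.
- rewrite sub_capmx; apply/andP; split.
    by rewrite !tgradedE tdiffE (degree_mx_red _ (@diff_homog _ resG i)) submxMl.
  case: i => [|i] /=; first exact: submx1.
  by apply/sub_kermxP; rewrite -mulmxA !tdiffE -red_mxM diffM // /red_mx map_mx0 mulmx0.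
- set C := (_ :&: _)%MS.
  have CE : C = C *m degree_mx K (@gen_deg _ _ F i) j.
    by rewrite degree_mx_sub // capmxSl.
  have hfg : homog_mx (@gen_deg _ _ F i) (@gen_deg _ _ F i) (f i *m g i).
    exact: homog_mxM.
  have Cc : C *m (red_mx (f i) *m red_mx (g i) - 1%:M) =
     C *m red_mx (h i) *m degree_mx K (@gen_deg _ _ F i.+1) j *m tdiff F i.
    transitivity (C *m red_mx (h i *m diff F i) *m degree_mx K (@gen_deg _ _ F i) j).
      have -> : C *m red_mx (h i *m diff F i) =
                C *m red_mx (f i *m g i - 1%:M).
        case: i @C CE hfg => [|i] C CE hfg; first by rewrite h0.
        rewrite hE /red_mx map_mxD -!/(red_mx _) mulmxDr.
        rewrite [red_mx (diff F i *m _)]red_mxM (mulmxA C) -tdiffE.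
        suff -> : C *m tdiff F i = 0 by rewrite mul0mx addr0.
        by apply/sub_kermxP; apply: capmxSr.
      rewrite red_mxB red_mx1 -red_mxM {1}CE -!mulmxA; congr (_ *m _).
      by rewrite mulmxBr (degree_mx_red _ hfg) mulmx1 mulmxBl mul1mx.
    rewrite red_mxM !mulmxA tdiffE -!mulmxA.
    by rewrite (degree_mx_red _ (@diff_homog _ resF i)).
  by rewrite Cc -mulmxA tgradedE submxMl.
Qed.

Lemma tor_dim_unique F G (resF : is_resolution I F) (resG : is_resolution I G) i j :
  tor_dim F i j = tor_dim G i j.
Proof. by apply/eqP; rewrite eqn_leq !tor_dim_le. Qed.

Lemma bettiE F (resF : is_resolution I F) i j : betti I i j = tor_dim F i j.
Proof.
apply: xget_unique; first by exists F.
by move=> _ [G resG ->]; apply: tor_dim_unique.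
Qed.

End Comparison.

(** * The augmented chain complex of a full simplex *)

Section SimplexChains.
Variables (K : pzRingType) (G : finType).
Implicit Types (p q : G) (L : {set G}) (c : {set G} -> K).

(** The incidence sign: the parity of the position of q in L, or of its place
    after insertion when q is not in L, for the order given by [enum_rank]. *)
Definition face_sign q L : K :=
  (-1) ^+ (\sum_(p in L) (enum_rank p < enum_rank q))%N.

(** Chains are functions on all subsets of G, the empty one included; this is
    the coefficient at L of the boundary of c. *)
Definition boundary c L : K :=
  \sum_(q | q \notin L) face_sign q L * c (q |: L).

(** The cone with apex q. *)
Definition contract q c L : K :=
  if q \in L then face_sign q L * c (L :\ q) else 0.

Lemma face_signU1 q p L : p \notin L ->
  face_sign q (p |: L) = (-1) ^+ (enum_rank p < enum_rank q)%N * face_sign q L.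
Proof. by move=> pL; rewrite /face_sign big_setU1 //= exprD. Qed.

Lemma face_signK q L x : face_sign q L * (face_sign q L * x) = x.
Proof. by rewrite mulrA -exprD addnn -mul2n exprM sqrrN expr1n expr1n mul1r. Qed.

Lemma face_sign_anti p q L : p != q -> p \notin L -> q \notin L ->
  face_sign q L * face_sign p (q |: L) =
    - (face_sign p L * face_sign q (p |: L)).
Proof.
move=> pq pL qL; rewrite !face_signU1 // /face_sign -!exprD.
set a := (\sum_(_ in L) _)%N; set b := (\sum_(_ in L) _)%N.
case: (ltngtP (enum_rank p) (enum_rank q)) => [_|_|/ord_inj/enum_rank_inj E].
- by rewrite add0n add1n addnS exprS mulN1r (addnC a) opprK.
- by rewrite add0n add1n addnS exprS mulN1r (addnC a).
- by rewrite E eqxx in pq.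
Qed.

(** Inserting p then q and q then p give opposite signs.  The terms are paired
    by comparing ranks, so that the argument also applies in characteristic
    2, where a = - a does not give a = 0. *)
Lemma boundary_boundary c L : boundary (boundary c) L = 0.
Proof.
pose a q p := face_sign q L * (face_sign p (q |: L) * c (p |: (q |: L))).
pose T q p := [&& q \notin L, p \notin L & p != q].
have -> : boundary (boundary c) L = \sum_q \sum_(p | T q p) a q p.
  rewrite /boundary big_mkcond; apply: eq_bigr => q _.
  case: ifP => qL; last by rewrite big_pred0 // => p; rewrite /T qL.
  rewrite mulr_sumr; apply: eq_big => // p.
  by rewrite /T qL finset.in_setU1 negb_or andbC.
under eq_bigr => q _ do
  rewrite (bigID (fun p : G => (enum_rank p < enum_rank q)%N)) /=.
rewrite big_split /= addrC [X in X + _](exchange_big_dep xpredT) //= -big_split /=.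
apply: big1 => p _; rewrite [X in X + _](eq_bigl
  (fun q : G => T p q && (enum_rank q < enum_rank p)%N)); last first.
  move=> q; rewrite /T [p == q]eq_sym andbCA -!andbA; do 2!congr (_ && _).
  have [->|pq] := eqVneq q p; first by rewrite ltnn.
  case: ltngtP => // /ord_inj/enum_rank_inj E; by rewrite E eqxx in pq.
rewrite -big_split /=; apply: big1 => q /andP [/and3P [pL qL qp] _].
by rewrite /a !mulrA finset.setUCA face_sign_anti 1?eq_sym // mulNr addNr.
Qed.

Lemma contract_setU1 q c L : q \notin L ->
  contract q c (q |: L) = face_sign q L * c L.
Proof. by move=> qL; rewrite /contract setU11 setU1K // face_signU1 // ltnn mul1r. Qed.

Lemma face_sign_swap p q L : p != q -> p \notin L -> q \notin L ->
  face_sign p (q |: L) * face_sign q (p |: L) =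
    - (face_sign q L * face_sign p L).
Proof.
move=> pq pL qL; rewrite !face_signU1 // /face_sign -!exprD.
set a := (\sum_(_ in L) _)%N; set b := (\sum_(_ in L) _)%N.
case: (ltngtP (enum_rank p) (enum_rank q)) => [_|_|/ord_inj/enum_rank_inj E].
- by rewrite add0n add1n addnS exprS mulN1r (addnC b).
- by rewrite add0n add1n addSn exprS mulN1r (addnC b).
- by rewrite E eqxx in pq.
Qed.

(** A full simplex is contractible to any of its vertices. *)
Lemma boundary_contract q c L :
  boundary (contract q c) L + contract q (boundary c) L = c L.
Proof.
have [qL|qL] := boolP (q \in L); last first.
  rewrite [contract _ _ L]ifN // addr0 /boundary (bigD1 q) //= big1 => [|p].
    by rewrite contract_setU1 // addr0 face_signK.
  by move=> /andP [pL pq]; rewrite /contract finset.in_setU1 eq_sym (negPf pq) (negPf qL) mulr0.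
rewrite -(finset.setD1K qL); set X := L :\ q.
have qX : q \notin X by rewrite !inE eqxx.
rewrite contract_setU1 // [in X in _ + X]/boundary (bigD1 q) //= mulrDr.
rewrite face_signK addrCA -[RHS]addr0; congr (_ + _).
rewrite /boundary [X in X + _](eq_bigl (fun p => (p \notin X) && (p != q))); last first.
  by move=> p; rewrite finset.in_setU1 negb_or andbC.
rewrite mulr_sumr -big_split; apply: big1 => p /andP [pX pq] /=.
rewrite finset.setUCA contract_setU1 ?finset.in_setU1 ?negb_or 1?eq_sym ?pq //.
by rewrite !mulrA face_sign_swap // mulNr addNr.
Qed.

End SimplexChains.

(** * The Taylor complex on finitely supported functions *)

Section Lcm.
Variables (N : nat) (G : finType) (m : G -> 'X_{1..N}).
Implicit Types (p q : G) (L : {set G}) (M : 'X_{1..N}).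

Definition set_lcm L : 'X_{1..N} := \big[@mlcm N/0%MM]_(q in L) m q.

Lemma set_lcm0 : set_lcm finset.set0 = 0%MM.
Proof. exact: big_set0. Qed.

Lemma set_lcm_le L M :
  (set_lcm L <= M)%MM = [forall (q | q \in L), (m q <= M)%MM].
Proof.
rewrite -big_andE /set_lcm.
apply: (big_morph (fun x => (x <= M)%MM)) => [x y|]; first exact: lem_mlcm.
by apply/mnm_lepP => i; rewrite mnm0E.
Qed.

Lemma set_lcm_leP {L M} :
  reflect (forall q, q \in L -> (m q <= M)%MM) (set_lcm L <= M)%MM.
Proof. by rewrite set_lcm_le; apply: 'forall_implyP. Qed.

Lemma set_lcmU1_le q L M :
  (set_lcm (q |: L) <= M)%MM = (m q <= M)%MM && (set_lcm L <= M)%MM.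
Proof.
apply/set_lcm_leP/andP => [h|[hq /set_lcm_leP hL] p].
  split; first by apply: h; rewrite finset.setU11.
  by apply/set_lcm_leP => p pL; apply: h; rewrite finset.in_setU1 pL orbT.
by rewrite finset.in_setU1 => /predU1P [->|/hL].
Qed.

Lemma set_lcm_leU1 q L : (set_lcm L <= set_lcm (q |: L))%MM.
Proof. by have := lepm_refl (set_lcm (q |: L)); rewrite {1}set_lcmU1_le => /andP []. Qed.

End Lcm.

Lemma mcoeffMX_if (K : nzRingType) N (p : {mpoly K[N]}) (a b : 'X_{1..N}) :
  (p * 'X_[a])@_b = if (a <= b)%MM then p@_(b - a) else 0.
Proof.
have [ab|ab] := boolP (a <= b)%MM.
  by rewrite -[in LHS](submK ab) [in LHS]addmC mcoeffMX.
apply: memN_msupp_eq0; rewrite (perm_mem (msuppMX _ _)).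
by apply/mapP => -[c _ bE]; rewrite bE lem_addr in ab.
Qed.

Section TaylorFunctions.
Variables (K : fieldType) (N : nat) (G : finType) (m : G -> 'X_{1..N}).
Local Notation S := {mpoly K[N]}.
Local Notation lcm := (set_lcm m).
Implicit Types (p q : G) (L : {set G}) (M : 'X_{1..N}) (v : {set G} -> S).

(** A chain of the Taylor complex is a function v on sets of generators, with
    polynomial values; restricting it to sets of i elements gives the i-th
    module. *)
Definition taylor_diff v L : S :=
  \sum_(q | q \notin L)
    face_sign K q L *: (v (q |: L) * 'X_[lcm (q |: L) - lcm L]).

(** The coefficient at x^(M - lcm L) e_L: the part of multidegree M of v is a
    scalar chain of the simplex of all generators. *)
Definition multidegree_part M v L : K :=
  if (lcm L <= M)%MM then (v L)@_(M - lcm L) else 0.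

Lemma multidegree_part_inj v w L :
  (forall M, multidegree_part M v L = multidegree_part M w L) -> v L = w L.
Proof.
move=> vw; apply/mpolyP => d; move: (vw (d + lcm L)%MM).
by rewrite /multidegree_part lem_addl addmK.
Qed.

(** In each multidegree the Taylor differential is a simplicial boundary. *)
Lemma multidegree_part_diff M v L :
  multidegree_part M (taylor_diff v) L = boundary (multidegree_part M v) L.
Proof.
rewrite /multidegree_part /boundary /taylor_diff raddf_sum /=.
have [LM|LM] := boolP (lcm L <= M)%MM; last first.
  by rewrite big1 // => q _; rewrite set_lcmU1_le (negPf LM) andbF mulr0.
apply: eq_bigr => q _; rewrite mcoeffZ mcoeffMX_if; congr (_ * _).
have qL := mnm_lepP (set_lcm_leU1 m q L).
have -> : (lcm (q |: L) - lcm L <= M - lcm L)%MM = (lcm (q |: L) <= M)%MM.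
  apply/mnm_lepP/mnm_lepP => h i; move: (h i); rewrite !mnmBE.
    by rewrite leq_subLR subnKC // (mnm_lepP LM).
  exact: leq_sub2r.
case: ifP => // _; congr (_ @_ _); apply/mnmP => i.
by rewrite !mnmBE -subnDA subnKC.
Qed.

Lemma taylor_diff_diff v L : taylor_diff (taylor_diff v) L = 0.
Proof.
apply: (@multidegree_part_inj _ (fun=> 0)) => M; rewrite multidegree_part_diff.
rewrite [RHS]/multidegree_part mcoeff0 if_same.
rewrite -[RHS](boundary_boundary (multidegree_part M v) L).
by apply: eq_bigr => q _; rewrite multidegree_part_diff.
Qed.

Definition contract_at M (c : {set G} -> K) L : K :=
  if [pick q | (m q <= M)%MM] is Some q then contract q c L else 0.

(** The K-linear map which is, in multidegree M, the cone over some generator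
    dividing M.  The bound on the monomials d only serves to make the sum
    finite: removing q from L decreases the lcm, so the coefficient at d is
    a coefficient of v at a monomial of degree at least that of d. *)
Definition taylor_contract v L : S :=
  \sum_(d : 'X_{1..N < \max_(L' : {set G}) msize (v L')})
     contract_at (d + lcm L)%MM (multidegree_part (d + lcm L)%MM v) L *: 'X_[d].

Lemma multidegree_part_contract M v L :
  multidegree_part M (taylor_contract v) L
    = contract_at M (multidegree_part M v) L.
Proof.
rewrite {1}/multidegree_part; case: ifP => LM; last first.
  rewrite /contract_at; case: pickP => // q qM; rewrite /contract.
  case: ifP => // qL; rewrite /multidegree_part.
  move: LM; rewrite -{1}(finset.setD1K qL) set_lcmU1_le qM /= => ->.
  by rewrite mulr0.
pose F d := contract_at (d + lcm L)%MM (multidegree_part (d + lcm L)%MM v) L.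
rewrite /taylor_contract; set k := (\max_L' msize (v L'))%N.
have [small|large] := ltnP (mdeg (M - lcm L)%MM) k.
  by rewrite (mcoeff_mpoly F small) /F submK.
rewrite memN_msupp_eq0.
  rewrite /contract_at; case: pickP => // q _; rewrite /contract.
  case: ifP => // qL; rewrite /multidegree_part; case: ifP => LM'; last by rewrite mulr0.
  rewrite memN_msupp_eq0 ?mulr0 //; apply: msize_mdeg_ge.
  apply: leq_trans (leq_bigmax (F := fun L' => msize (v L')) (L :\ q)) _.
  apply: leq_trans large _; rewrite !mdegE; apply: leq_sum => i _.
  rewrite !mnmBE leq_sub2l //.
  have := set_lcm_leU1 m q (L :\ q); rewrite finset.setD1K // => /mnm_lepP.
  exact.
rewrite mcoeff_msupp negbK raddf_sum big1 //= => -[d /= d_k] _.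
rewrite mcoeffZ mcoeffX; case: eqP => [dE|_]; last by rewrite mulr0.
by rewrite dE ltnNge large in d_k.
Qed.

(** The contracting homotopy works in the multidegrees divisible by some
    generator; the hypothesis says that v lives there at L. *)
Lemma taylor_homotopy v L :
  (forall d, (v L)@_d != 0 -> exists q, (m q <= d + lcm L)%MM) ->
  taylor_diff (taylor_contract v) L + taylor_contract (taylor_diff v) L = v L.
Proof.
move=> hv; apply: (multidegree_part_inj (v := fun L => _ + _)) => M.
transitivity (multidegree_part M (taylor_diff (taylor_contract v)) L
  + multidegree_part M (taylor_contract (taylor_diff v)) L).
  by rewrite /multidegree_part; case: ifP => _; rewrite ?mcoeffD ?addr0.
rewrite multidegree_part_diff multidegree_part_contract /boundary.
under eq_bigr => q _ do rewrite multidegree_part_contract.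
rewrite /contract_at; case: pickP => [q _|noq].
  rewrite -[RHS](boundary_contract q); congr (_ + _).
  by rewrite /contract; case: ifP => // _; rewrite multidegree_part_diff.
rewrite big1 ?add0r => [|q _]; last by rewrite mulr0.
rewrite /multidegree_part; case: ifP => // LM; apply/esym/eqP.
apply: contraT => /hv [q]; by rewrite submK // noq.
Qed.

Lemma taylor_contract_supp i v :
  (forall L, #|L| != i -> v L = 0) ->
  forall L, #|L| != i.+1 -> taylor_contract v L = 0.
Proof.
move=> hv L Li; rewrite /taylor_contract big1 // => d _.
rewrite /contract_at; case: pickP => [q _|_]; last by rewrite scale0r.
rewrite /contract; case: ifP => qL; last by rewrite scale0r.
rewrite /multidegree_part hv ?mcoeff0 ?if_same ?mulr0 ?scale0r //.
by apply: contraNneq Li => <-; rewrite (cardsD1 q L) qL.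
Qed.

End TaylorFunctions.

(** * Monomial ideals *)

Section MonomialIdeal.
Variables (K : fieldType) (N : nat) (G : finType) (m : G -> 'X_{1..N}).
Local Notation S := {mpoly K[N]}.

Definition monomial_ideal : set S :=
  ideal_span (fun f => exists q, f = 'X_[m q]).

Lemma monomial_ideal0 : monomial_ideal 0.
Proof. by exists [::]; rewrite big_nil. Qed.

Lemma monomial_idealD p q :
  monomial_ideal p -> monomial_ideal q -> monomial_ideal (p + q).
Proof.
move=> [s [hs ->]] [t [ht ->]]; exists (s ++ t); split; last by rewrite big_cat.
by move=> u; rewrite mem_cat => /orP [/hs|/ht].
Qed.

Lemma monomial_idealM p q : monomial_ideal q -> monomial_ideal (p * q).
Proof.
move=> [s [hs ->]]; exists [seq (p * u.1, u.2) | u <- s]; split.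
  by move=> _ /mapP [u /hs ? ->].
by rewrite big_map mulr_sumr; apply: eq_bigr => u _; rewrite mulrA.
Qed.

Lemma monomial_ideal_sum (J : Type) (r : seq J) (P : pred J) (F : J -> S) :
  (forall j, P j -> monomial_ideal (F j)) ->
  monomial_ideal (\sum_(j <- r | P j) F j).
Proof.
move=> h; apply: (big_ind monomial_ideal) => //.
  exact: monomial_ideal0.
exact: monomial_idealD.
Qed.

Lemma monomial_idealMX p a q : (m q <= a)%MM -> monomial_ideal (p * 'X_[a]).
Proof.
move=> qa; rewrite -(submK qa) mpolyXD mulrA; apply: monomial_idealM.
exists [:: (1, 'X_[m q])]; split; last by rewrite big_seq1 mul1r.
by move=> u; rewrite inE => /eqP ->; exists q.
Qed.

Lemma monomial_idealP p :
  monomial_ideal p <-> forall d, p@_d != 0 -> exists q, (m q <= d)%MM.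
Proof.
split=> [[s [hs ->]] d|h].
  apply: contra_neqP => noq; rewrite raddf_sum big_seq big1 //= => u.
  move=> /hs [q ->]; rewrite mcoeffMX_if ifN //.
  by apply/negP => qd; apply: noq; exists q.
rewrite (mpolyE p) big_seq; apply: monomial_ideal_sum => d.
rewrite mcoeff_msupp => /h [q qd].
by rewrite -mul_mpolyC; apply: monomial_idealMX qd.
Qed.

Lemma monomial_ideal_pihomog d p :
  monomial_ideal p -> monomial_ideal (pihomog mdeg d p).
Proof.
move=> /monomial_idealP h; rewrite pihomogE big_seq_cond.
apply: monomial_ideal_sum => a /andP [].
rewrite mcoeff_msupp => /h [q qa] _.
by rewrite -mul_mpolyC; apply: monomial_idealMX qa.
Qed.

End MonomialIdeal.

Lemma mdegB_le N (a b : 'X_{1..N}) : (b <= a)%MM ->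
  mdeg (a - b) = (mdeg a - mdeg b)%N.
Proof. by move=> ba; rewrite -{2}(submK ba) mdegD addnK. Qed.

Lemma mdeg_le N (a b : 'X_{1..N}) : (b <= a)%MM -> (mdeg b <= mdeg a)%N.
Proof. by move=> ba; rewrite -(submK ba) mdegD leq_addl. Qed.

(** * The Taylor resolution *)

Section TaylorResolution.
Variables (K : fieldType) (N : nat) (G : finType) (m : G -> 'X_{1..N}).
Local Notation S := {mpoly K[N]}.
Local Notation lcm := (set_lcm m).
Implicit Types (q : G) (L : {set G}).

Definition faces i : {set {set G}} := [set L : {set G} | #|L| == i]%SET.

Definition face i (u : 'I_#|faces i|) : {set G} := enum_val u.

Definition taylor : graded_free K N :=
  @GradedFree K N (fun i => #|faces i|) (fun i u => mdeg (lcm (face u)))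
    (fun i => \matrix_(u, v)
       \sum_(q | (q \notin face v) && (face u == q |: face v))
          face_sign K q (face v) *: 'X_[lcm (face u) - lcm (face v)])
    (const_mx 1).

Lemma card_face i (u : 'I_#|faces i|) : #|face u| = i.
Proof. by have := enum_valP u; rewrite inE => /eqP. Qed.

Lemma faceP i L : #|L| == i -> exists u : 'I_#|faces i|, face u = L.
Proof.
move=> Li; have LA : L \in faces i by rewrite inE.
by exists (enum_rank_in LA L); apply: enum_rankK_in.
Qed.

(** Summing over the indices u with face L, of which there is at most one,
    extends v by zero to all sets without a case distinction. *)
Definition chain_of i (v : 'rV[S]_#|faces i|) L : S := \sum_(u | face u == L) v 0 u.

Definition row_of i (c : {set G} -> S) : 'rV[S]_#|faces i| := \row_u c (face u).

Lemma chain_of_face i (v : 'rV_#|faces i|) u : chain_of v (face u) = v 0 u.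
Proof.
rewrite /chain_of (big_pred1 u) // => w; apply/eqP/eqP => [|->//].
exact: enum_val_inj.
Qed.

Lemma chain_of_supp i (v : 'rV_#|faces i|) L : #|L| != i -> chain_of v L = 0.
Proof.
move=> Li; rewrite /chain_of big_pred0 // => u.
by apply: contraNF Li => /eqP <-; rewrite card_face.
Qed.

Lemma chain_of_inj i (v w : 'rV_#|faces i|) : chain_of v =1 chain_of w -> v = w.
Proof. by move=> vw; apply/rowP => u; rewrite -!chain_of_face. Qed.

Lemma chain_of_row i c : (forall L, #|L| != i -> c L = 0) ->
  chain_of (row_of i c) =1 c.
Proof.
move=> hc L; have [/faceP [u <-]|Li] := boolP (#|L| == i).
  by rewrite chain_of_face mxE.
by rewrite chain_of_supp // hc.
Qed.

Lemma eq_taylor_diff (c c' : {set G} -> S) : c =1 c' -> taylor_diff m c =1 taylor_diff m c'.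
Proof. by move=> cc L; apply: eq_bigr => q _; rewrite cc. Qed.

Lemma taylor_diff_supp i (c : {set G} -> S) : (forall L, #|L| != i.+1 -> c L = 0) ->
  forall L, #|L| != i -> taylor_diff m c L = 0.
Proof.
move=> hc L Li; apply: big1 => q qL; rewrite hc ?mul0r ?scaler0 //.
by rewrite cardsU1 qL add1n eqSS.
Qed.

Lemma chain_of_diff i (v : 'rV_#|faces i.+1|) :
  chain_of (v *m diff taylor i) =1 taylor_diff m (chain_of v).
Proof.
move=> L; have [/faceP [u <-]|Li] := boolP (#|L| == i); last first.
  rewrite chain_of_supp // (taylor_diff_supp (i := i)) //.
  exact: chain_of_supp.
rewrite chain_of_face mxE /taylor_diff.
under eq_bigr => w _ do rewrite mxE mulr_sumr.
rewrite (exchange_big_dep (fun q => q \notin face u)) /=; last by move=> w q _ /andP [].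
apply: eq_bigr => q qu; rewrite /chain_of mulr_suml scaler_sumr.
apply: eq_big => [w|w /andP [_ /eqP ->]]; first by rewrite qu.
by rewrite scalerAr.
Qed.

Lemma mulmx_taylor_aug (v : 'rV_#|faces 0|) :
  (v *m aug taylor) 0 0 = chain_of v finset.set0.
Proof.
rewrite mxE /chain_of; apply: eq_big => [u|u _]; last by rewrite mxE mulr1.
by rewrite -cards_eq0 card_face.
Qed.

(** The contraction of a cycle is a preimage of it.  In positive homological
    degree the second hypothesis is automatic, since every element of L
    divides lcm L; in degree 0 it is membership in the ideal. *)
Lemma taylor_exact i (v : 'rV_#|faces i|) :
  (forall L, taylor_diff m (chain_of v) L = 0) ->
  (forall L d, (chain_of v L)@_d != 0 -> exists q, (m q <= d + lcm L)%MM) ->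
  exists w, v = w *m diff taylor i.
Proof.
move=> dv hv; exists (row_of i.+1 (taylor_contract m (chain_of v))).
apply: chain_of_inj => L; rewrite chain_of_diff.
rewrite (eq_taylor_diff (chain_of_row _)); last first.
  by apply: taylor_contract_supp => L' ?; rewrite chain_of_supp.
rewrite -[LHS](taylor_homotopy (hv L)) [X in _ + X](taylor_contract_supp m (i := #|L|)) ?addr0 //.
by rewrite eqn_leq ltnn andbF.
Qed.

Lemma taylor_resolution : is_resolution (@monomial_ideal K N G m) taylor.
Proof.
split=> /=.
- move=> i u v; rewrite mxE.
  case: leqP => uv; last first.
    rewrite big1 // => q /andP [_ /eqP uE].
    by move: uv; rewrite uE ltnNge mdeg_le // set_lcm_leU1.
  apply: rpred_sum => q /andP [_ /eqP uE]; apply: rpredZ.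
  by rewrite dhomogX /= mdegB_le // uE set_lcm_leU1.
- move=> u; rewrite mxE; have /eqP := card_face u.
  by rewrite cards_eq0 => /eqP ->; rewrite set_lcm0 mdeg0 dhomog1.
- move=> p; exists (row_of 0 (fun=> p)); rewrite mulmx_taylor_aug.
  have /faceP [u <-] : #|(finset.set0 : {set G})| == 0 by rewrite cards0.
  by rewrite chain_of_face mxE subrr; apply: monomial_ideal0.
- move=> v; rewrite mulmx_taylor_aug; split=> [vI|[w ->]].
    apply: taylor_exact => [L|L d].
      rewrite /taylor_diff big1 // => q qL.
      by rewrite chain_of_supp ?mul0r ?scaler0 // cardsU1 qL.
    have [->|L0] := eqVneq L finset.set0.
      by rewrite set_lcm0 addm0; move/monomial_idealP: vI; exact.
    by rewrite chain_of_supp ?mcoeff0 ?eqxx // cards_eq0.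
  rewrite chain_of_diff; apply: monomial_ideal_sum => q _.
  rewrite scalerAl; apply: (@monomial_idealMX _ _ _ _ _ _ q).
  rewrite set_lcm0 subm0.
  by move/set_lcm_leP: (lepm_refl (lcm (q |: finset.set0))); apply; rewrite finset.setU11.
- move=> i v; split=> [v0|[w ->]].
    apply: taylor_exact => [L|L d].
      by rewrite -chain_of_diff v0 /chain_of big1 // => u _; rewrite mxE.
    have [Li|Li] := boolP (#|L| == i.+1); last first.
      by rewrite chain_of_supp // mcoeff0 eqxx.
    have /finset.set0Pn [q qL] : L != finset.set0 by rewrite -cards_eq0 (eqP Li).
    move=> _; exists q; apply: lepm_trans (lem_addl _ _).
    by move/set_lcm_leP: (lepm_refl (lcm L)); apply.
  apply: chain_of_inj => L; rewrite chain_of_diff.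
  rewrite (eq_taylor_diff (chain_of_diff _)) taylor_diff_diff.
  by rewrite /chain_of big1 // => u _; rewrite mxE.
Qed.

(** Each generator outside L strictly increases the lcm: the Taylor complex is
    then a minimal resolution. *)
Hypothesis minimal : forall q L, q \notin L -> ~~ (m q <= lcm L)%MM.

Lemma tdiff_taylor i : tdiff taylor i = 0.
Proof.
apply/matrixP => u v; rewrite !mxE raddf_sum big1 //= => q /andP [qv /eqP ->].
rewrite mcoeffZ mcoeffX; case: eqP => [E|_]; last by rewrite mulr0.
have := minimal qv; have := lepm_refl (lcm (q |: face v)).
rewrite {1}set_lcmU1_le => /andP [+ _].
by rewrite -(submK (set_lcm_leU1 m q (face v))) E add0m => ->.
Qed.

Lemma tor_dim_taylor i j :
  tor_dim taylor i j = #|[set L : {set G} | (#|L| == i) && (mdeg (lcm L) == j)]%SET|.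
Proof.
rewrite /tor_dim tdiff_taylor mulmx0 mxrank0 subn0.
have /capmx_idPl -> : (tgraded taylor i j <= tcycles taylor i)%MS.
  case: i => [|i] /=; first exact: submx1.
  by apply/sub_kermxP; rewrite tdiff_taylor mulmx0.
rewrite tgradedE rank_degree_mx.
rewrite -(card_imset _ (@enum_val_inj _ (mem (faces i)))).
apply: eq_card => L; rewrite inE; apply/imsetP/andP => [[u]|[Li Lj]].
  by rewrite inE => uj ->; rewrite card_face.
by have [u uE] := faceP Li; exists u; rewrite ?inE /= ?uE.
Qed.

Lemma betti_taylor i j :
  betti (@monomial_ideal K N G m) i j
    = #|[set L : {set G} | (#|L| == i) && (mdeg (lcm L) == j)]%SET|.
Proof.
rewrite (bettiE _ _ _ _ taylor_resolution) ?tor_dim_taylor //.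
- exact: monomial_ideal0.
- exact: monomial_idealD.
- exact: monomial_idealM.
- exact: monomial_ideal_pihomog.
Qed.

End TaylorResolution.

(** * Paths from the root and words of length n *)

Section Paths.
Variables k n : nat.
Local Notation word := (n.-tuple 'I_k).
Implicit Types (v : vertex k n) (w : word) (e : edge k n).

(** An edge is determined by its lower end, and it lies on the path to the leaf
    w exactly when that end is a prefix of w. *)
Definition word_edges w : {set edge k n} :=
  [set e : edge k n | seq.prefix (val e).2 w]%SET.

Lemma childP v v' :
  reflect (exists a, val v' = rcons v a) (child v v').
Proof. by apply: (iffP existsP) => -[a /eqP]; exists a => //; apply/eqP. Qed.

Lemma child_inj v1 v2 v : child v1 v -> child v2 v -> v1 = v2.
Proof.
move=> /childP [a va] /childP [b vb]; apply: val_inj.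
by have /rcons_inj [] : rcons v1 a = rcons v2 b by rewrite -va -vb.
Qed.

Lemma child_size v v' : child v v' -> size v' = (size v).+1.
Proof. by move=> /childP [a ->]; rewrite size_rcons. Qed.

Lemma child_prefix v v' : child v v' -> seq.prefix v v'.
Proof. by move=> /childP [a ->]; rewrite prefix_rcons. Qed.

Lemma path_prefix v p : path (@child k n) v p -> seq.prefix v (last v p).
Proof.
elim: p v => [|u p IHp] v /=; first by rewrite prefix_refl.
by move=> /andP [/child_prefix vu /IHp]; apply: prefix_trans.
Qed.

Lemma prefix_eq (s1 s2 s : seq 'I_k) :
  seq.prefix s1 s -> seq.prefix s2 s -> size s1 = size s2 -> s1 = s2.
Proof. by rewrite !prefixE => /eqP E1 /eqP E2 E; rewrite -[LHS]E1 E. Qed.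

(** A path that goes down by one letter at a time visits each prefix of its
    end point which is longer than its origin. *)
Lemma mem_zip_path v p (e : vertex k n * vertex k n) :
  path (@child k n) v p ->
  (e \in zip (v :: p) p)
    = [&& child e.1 e.2, seq.prefix e.2 (last v p) & size v < size e.2]%N.
Proof.
elim: p v => [|u p IHp] v.
  move=> _; rewrite in_nil; apply/esym/negP => /and3P [_ /size_prefix].
  by rewrite leqNgt => /negP.
move=> /= /andP [vu up]; rewrite in_cons {}IHp //.
have [->|ne] /= := eqVneq e (v, u).
  by rewrite vu (path_prefix up) (child_size vu) ltnSn.
case: (boolP (child e.1 e.2)) => //= ce; case: (boolP (seq.prefix _ _)) => //= pe.
rewrite (child_size vu) [in RHS]leq_eqVlt; case: eqP => //= E.
case/negP: ne; have e2 : e.2 = u.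
  apply: val_inj; apply: prefix_eq pe (path_prefix up) _.
  by rewrite (child_size vu).
apply/eqP; rewrite [e]surjective_pairing e2; congr (_, _).
by apply: child_inj vu; rewrite -e2.
Qed.

Lemma path_edgesE p w : path (@child k n) (root_vertex k n) p ->
  last (root_vertex k n) p = w :> seq _ -> path_edges p = word_edges w.
Proof.
move=> hp hw; apply/setP => e; rewrite !inE mem_zip_path // hw.
have ce := valP e; rewrite ce /=; case: seq.prefix => //=.
by rewrite (child_size ce).
Qed.

Lemma vertex_path v : exists2 p,
  path (@child k n) (root_vertex k n) p & last (root_vertex k n) p = v.
Proof.
case: v => s; elim/last_ind: s => [|s a IHs] hs.
  by exists [::] => //; apply: val_inj.
have hs' : (size s <= n)%N by apply: ltnW; rewrite -(size_rcons s a).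
have [p hp lp] := IHs hs'; exists (rcons p (Bseq hs)); last by rewrite last_rcons.
by rewrite rcons_path hp lp; apply/childP; exists a.
Qed.

Lemma leafE v : (0 < k)%N -> leaf v = (size v == n).
Proof.
move=> k0; apply/forallP/eqP => [h|vn v']; last first.
  by apply/negP => /child_size vv'; have := size_bseq v'; rewrite vv' vn ltnn.
apply/eqP; rewrite eqn_leq size_bseq leqNgt; apply/negP => vn.
have hs : (size (rcons v (Ordinal k0)) <= n)%N by rewrite size_rcons.
have /negP := h (Bseq hs); apply; apply/childP.
by exists (Ordinal k0).
Qed.

Lemma root_leaf_pathE (P : {set edge k n}) : (0 < k)%N ->
  root_leaf_path P <-> exists w, P = word_edges w.
Proof.
move=> k0; split=> [[p [hp]]|[w ->]].
  rewrite leafE // => lp ->; exists (Tuple lp); exact: path_edgesE.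
have hw : (size w <= n)%N by rewrite size_tuple.
have [p hp lp] := vertex_path (Bseq hw).
exists p; split=> //; first by rewrite lp leafE //= size_tuple.
by rewrite (@path_edgesE _ w) ?lp.
Qed.

Definition prefixes (L : {set word}) : {set vertex k n} :=
  [set v : vertex k n | [exists (w | w \in L), seq.prefix v w]]%SET.

Lemma edge_of v : v != root_vertex k n -> exists e : edge k n, (val e).2 = v.
Proof.
case: v => s; case/lastP: s => [|s a] hs; first by move/negP; case; apply/eqP/val_inj.
have hs' : (size s <= n)%N by apply: ltnW; rewrite -(size_rcons s a).
have cs : child (Bseq hs' : vertex k n) (Bseq hs) by apply/childP; exists a.
by exists (exist (fun vw : vertex k n * vertex k n => child vw.1 vw.2) (_, _) cs).
Qed.

Lemma edge_end_inj : injective (fun e : edge k n => (val e).2).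
Proof.
move=> e e' /= E; apply: val_inj; rewrite [val e]surjective_pairing
  [val e']surjective_pairing E; congr (_, _).
by apply: child_inj (valP e'); rewrite -E; exact: (valP e).
Qed.

Lemma edge_end_neq (e : edge k n) : (val e).2 != root_vertex k n.
Proof. by apply/eqP => E; have := child_size (valP e); rewrite E. Qed.

(** Counting edges by their lower ends. *)
Lemma card_word_edges (L : {set word}) :
  #|(\bigcup_(w in L) word_edges w)%SET| = #|(prefixes L :\ root_vertex k n)%SET|.
Proof.
rewrite -(card_imset _ edge_end_inj); apply: eq_card => v.
apply/imsetP/setD1P => [[e /bigcupP [w wL]]|[/edge_of [e <-]]].
  rewrite inE => ew ->; rewrite edge_end_neq inE; split=> //.
  by apply/existsP; exists w; rewrite wL.
rewrite inE => /existsP [w /andP [wL ew]]; exists e => //.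
by apply/bigcupP; exists w; rewrite ?inE.
Qed.

Lemma root_prefixes (L : {set word}) :
  (root_vertex k n \in prefixes L) = (L != finset.set0).
Proof.
rewrite inE; apply/existsP/finset.set0Pn => [[w /andP [wL _]]|[w wL]]; exists w => //.
by rewrite wL prefix0s.
Qed.

Definition path_monomial w : 'X_{1..#|edge k n|} :=
  [multinom (enum_val i \in word_edges w : nat) | i < #|edge k n|].

Lemma path_monomialE (K : fieldType) w :
  \prod_(e in word_edges w) 'X_(enum_rank e) = 'X_[path_monomial w] :> {mpoly K[_]}.
Proof.
rewrite mprodXE; congr 'X_[_]; apply/mnmP => i; rewrite mnm_sumE mnmE.
under eq_bigr => e _ do rewrite mnm1E.
have [iw|iw] := boolP (enum_val i \in word_edges w).
  rewrite (bigD1 (enum_val i)) //= enum_valK eqxx big1 // => e /andP [_ ei].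
  by rewrite -(inj_eq enum_val_inj) enum_rankK (negPf ei).
rewrite big1 // => e ew; rewrite -(inj_eq enum_val_inj) enum_rankK.
by case: eqP => // E; rewrite -E ew in iw.
Qed.

Lemma path_idealE (K : fieldType) : (0 < k)%N ->
  path_ideal (K := K) (k := k) (n := n) = monomial_ideal path_monomial.
Proof.
move=> k0; rewrite /path_ideal /monomial_ideal; congr ideal_span.
apply: funext => f; apply: propext; split=> [[P [/(root_leaf_pathE _ k0) [w ->] ->]]|[w ->]].
  by exists w; rewrite path_monomialE.
exists (word_edges w); rewrite path_monomialE; split=> //.
by apply/(root_leaf_pathE _ k0); exists w.
Qed.

Lemma path_lcmE L i :
  set_lcm path_monomial L i = (enum_val i \in (\bigcup_(w in L) word_edges w)%SET) :> nat.
Proof.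
have -> : set_lcm path_monomial L i = \max_(w in L) path_monomial w i.
  by apply: (big_morph (fun M : 'X_{1..#|edge k n|} => M i)) => [x y|]; rewrite mnmE.
apply/eqP; rewrite eqn_leq; apply/andP; split.
  apply/bigmax_leqP => w wL; rewrite mnmE.
  case: (boolP (enum_val i \in word_edges w)) => // iw.
  suff -> : enum_val i \in (\bigcup_(w in L) word_edges w)%SET by [].
  by apply/bigcupP; exists w.
case: (boolP (_ \in _)) => // /bigcupP [w wL iw].
by apply: leq_trans (leq_bigmax_cond _ wL); rewrite mnmE iw.
Qed.

Lemma mdeg_path_lcm L :
  mdeg (set_lcm path_monomial L) = #|(prefixes L :\ root_vertex k n)%SET|.
Proof.
rewrite mdegE -card_word_edges -sum1_card [RHS]big_mkcond.
under eq_bigr => i _ do rewrite path_lcmE.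
rewrite [RHS](reindex _ (onW_bij _ (@enum_val_bij (edge k n)))).
by apply: eq_bigr => i _; case: (_ \in _).
Qed.

(** The edge that ends at the leaf w lies on no path to another leaf. *)
Lemma path_monomial_minimal w (L : {set word}) : (0 < n)%N -> w \notin L ->
  ~~ (path_monomial w <= set_lcm path_monomial L)%MM.
Proof.
move=> n0 wL; have hw : (size w <= n)%N by rewrite size_tuple.
have [|e ew] := @edge_of (Bseq hw).
  by apply: contraTneq n0 => /(congr1 (size \o val)) /=; rewrite size_tuple => ->.
apply/negP => /mnm_lepP /(_ (enum_rank e)).
rewrite path_lcmE mnmE enum_rankK inE ew prefix_refl /=.
case: (boolP (_ \in _)) => // /bigcupP [w' w'L]; rewrite inE ew /= => pw _.
case/negP: wL; suff -> : w = w' by [].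
apply: val_inj; apply: prefix_eq pw (prefix_refl _) _.
by rewrite !size_tuple.
Qed.

End Paths.

(** * The generating function as a sum over sets of leaves *)

(** Only the values taken by g contribute, hence the sum over i is finite
    although I may not be. *)
Lemma fsbig_card_fibers (R : pzSemiRingType) (T : finType) (I : choiceType)
    (g : T -> I) (P : pred I) (F : I -> R) :
  \sum_(i \in [set` P]) #|[set z | g z == i]%SET|%:R * F i
    = \sum_(z | P (g z)) F (g z).
Proof.
pose r := undup (map g (enum T)).
have memr z : g z \in r by rewrite mem_undup map_f // mem_enum.
rewrite -(@bigfs _ _ _ _ r) ?undup_uniq // => [|i _ ir]; last first.
  rewrite (_ : #|_| = 0%N) ?mul0r //; apply: eq_card0 => z; rewrite inE.
  by apply: contraNF ir => /eqP <-.
rewrite [RHS]big_mkcond [LHS]big_mkcond /=.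
transitivity (\sum_(i <- r) \sum_(z | g z == i) (if P (g z) then F (g z) else 0)).
  apply: eq_bigr => i _; rewrite (eq_bigr (fun=> if P i then F i else 0)).
    rewrite sumr_const cardsE mulr_natl.
    by case: (P i); rewrite ?mul0rn.
  by move=> z /eqP ->.
rewrite (exchange_big_dep xpredT) //=; apply: eq_bigr => z _.
rewrite big_mkcond (bigD1_seq (g z)) ?undup_uniq ?memr //= eqxx.
by rewrite big1 ?addr0 // => i gi; rewrite eq_sym (negPf gi).
Qed.


Lemma card_cons_fibers (I U T : finType) (h : I -> U -> T) (A : {set T}) :
  (forall i i' u u', h i u = h i' u' -> i = i' /\ u = u') ->
  (forall x, x \in A -> exists i u, x = h i u) ->
  #|A| = (\sum_i #|[set u | h i u \in A]%SET|)%N.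
Proof.
move=> h_inj h_surj.
transitivity #|[set iu : I * U | h iu.1 iu.2 \in A]%SET|.
  rewrite -(card_in_imset (f := fun iu => h iu.1 iu.2)); last first.
    by move=> [i u] [i' u'] _ _ /= /h_inj [-> ->].
  apply: eq_card => x; apply/idP/imsetP => [xA|[[i u]]]; last by rewrite inE => ? ->.
  by have [i [u xE]] := h_surj x xA; exists (i, u); rewrite // inE /= -xE.
rewrite -sum1_card; under eq_bigl => iu do rewrite inE.
rewrite -(pair_big_dep xpredT (fun i u => h i u \in A) (fun _ _ => 1%N)) /=.
by apply: eq_bigr => i _; rewrite -sum1_card; apply: eq_bigl => u; rewrite inE.
Qed.

(** * Splitting a set of leaves at the root *)

Section SubtreeRecursion.
Variables (k n : nat).
Implicit Types (a : 'I_k) (L : {set n.+1.-tuple 'I_k}).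

(** The leaves of L below the child a of the root, seen in the subtree at a. *)
Definition branch L a : {set n.-tuple 'I_k} :=
  [set w : n.-tuple 'I_k | [tuple of a :: w] \in L]%SET.

Lemma card_branch L : #|L| = (\sum_a #|branch L a|)%N.
Proof.
apply: card_cons_fibers => [a a' w w' /(congr1 val) [-> /val_inj ->] //|w _].
by exists (thead w), (behead_tuple w); rewrite -tuple_eta.
Qed.

Lemma branch_prefixes L a (v : vertex k n) :
  (v \in prefixes (branch L a)) = ([bseq of a :: v] \in prefixes L).
Proof.
rewrite !inE; apply/existsP/existsP => -[w /andP []].
  by rewrite inE => aw vw; exists [tuple of a :: w]; rewrite aw /= eqxx.
case/tupleP: w => b w bw /= /andP [/eqP ab vw].
by exists w; rewrite inE ab vw andbT; apply: etrans bw; congr (_ \in L); apply: val_inj.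
Qed.

(** A nonempty prefix of a word of L is a letter a followed by a possibly empty
    prefix of a word of [branch L a]; the empty one stands for the edge from
    the root to a. *)
Lemma card_prefixes_branch L :
  #|(prefixes L :\ root_vertex k n.+1)%SET| = (\sum_a #|prefixes (branch L a)|)%N.
Proof.
rewrite (@card_cons_fibers _ _ _ (fun a (v : vertex k n) => [bseq of a :: v] : vertex k n.+1)).
- apply: eq_bigr => a _; apply: eq_card => v.
  by rewrite branch_prefixes !inE; apply: andb_idl.
- by move=> a a' v v' /(congr1 val) [-> /val_inj ->].
- case=> [[|a s] hs]; first by case/setD1P => /eqP []; apply: val_inj.
  by move=> _; exists a, (Bseq (hs : (size s <= n)%N)); apply: val_inj.
Qed.

End SubtreeRecursion.

Lemma card_prefixes k n (L : {set n.-tuple 'I_k}) :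
  #|prefixes L| = ((L != finset.set0) + #|(prefixes L :\ root_vertex k n)%SET|)%N.
Proof. by rewrite (cardsD1 (root_vertex k n)) root_prefixes. Qed.

Definition path_set_gf (R : comNzRingType) (k n : nat) (x t : R) : R :=
  \sum_(L : {set n.-tuple 'I_k})
     x ^+ #|L| * t ^+ #|(prefixes L :\ root_vertex k n)%SET|.

Lemma prefixes0 k n : prefixes (finset.set0 : {set n.-tuple 'I_k}) = finset.set0.
Proof.
apply/setP => v; rewrite !inE; apply/negbTE/negP => /existsP [w].
by rewrite inE.
Qed.

(** Counting the empty prefix as well multiplies the term of each nonempty L by
    t and does not change that of the empty set. *)
Lemma sum_prefixes (R : comNzRingType) k n (x t : R) :
  \sum_(L : {set n.-tuple 'I_k}) x ^+ #|L| * t ^+ #|prefixes L|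
    = 1 + t * (path_set_gf k n x t - 1).
Proof.
rewrite /path_set_gf (bigD1 finset.set0) //= [in RHS](bigD1 finset.set0) //=.
rewrite prefixes0 finset.set0D !cards0 !expr0 mulr1; congr (_ + _).
rewrite [1 + _]addrC addrK mulr_sumr; apply: eq_bigr => L L0.
by rewrite card_prefixes L0 exprS mulrCA.
Qed.

(** Expanding the k-th power sums over the k-tuples of sets of words of length
    n, and gluing such tuples gives all sets of words of length n + 1. *)
Lemma path_set_gf_rec (R : comNzRingType) k n (x t : R) :
  path_set_gf k n.+1 x t = (1 + t * (path_set_gf k n x t - 1)) ^+ k.
Proof.
rewrite -sum_prefixes -[X in _ ^+ X]card_ord -prodr_const bigA_distr_bigA /=.
pose glue (f : {ffun 'I_k -> {set n.-tuple 'I_k}}) : {set n.+1.-tuple 'I_k} :=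
  [set w : n.+1.-tuple 'I_k | behead_tuple w \in f (thead w)]%SET.
have branch_glue f a : branch (glue f) a = f a.
  apply/setP => w; rewrite !inE theadE.
  by have -> : behead_tuple [tuple of a :: w] = w by exact: val_inj.
have glueK L : glue [ffun a => branch L a] = L.
  by apply/setP => w; rewrite inE ffunE inE -tuple_eta.
rewrite /path_set_gf (reindex glue); last first.
  exists (fun L => [ffun a => branch L a]) => [f _|L _]; last exact: glueK.
  by apply/ffunP => a; rewrite ffunE branch_glue.
apply: eq_bigr => f _; rewrite card_branch card_prefixes_branch !expr_sum -big_split.
by apply: eq_bigr => a _; rewrite branch_glue.
Qed.

Lemma prefixes_gt0 k n (L : {set n.-tuple 'I_k}) : (0 < n)%N ->
  (0 < #|(prefixes L :\ root_vertex k n)%SET|)%N = (L != finset.set0).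
Proof.
move=> n0; have [->|/finset.set0Pn [w wL]] := eqVneq L finset.set0.
  by rewrite prefixes0 finset.set0D cards0.
have hw : (size w <= n)%N by rewrite size_tuple.
apply/card_gt0P; exists (Bseq hw); rewrite !inE; apply/andP; split.
  by apply: contraTneq n0 => /(congr1 (size \o val)) /=; rewrite size_tuple => ->.
by apply/existsP; exists w; rewrite wL prefix_refl.
Qed.

Lemma betti_gfE (K : fieldType) k n : (0 < k)%N -> (0 < n)%N ->
  betti_gf K k n = path_set_gf k n var_x var_t - 1.
Proof.
move=> k0 n0; pose g (L : {set n.-tuple 'I_k}) :=
  (#|L|, #|(prefixes L :\ root_vertex k n)%SET|).
pose F (ij : nat * nat) : {poly {poly int}} := var_x ^+ ij.1 * var_t ^+ ij.2.
transitivity (\sum_(L | (0 < (g L).1)%N && (0 < (g L).2)%N) F (g L)).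
  rewrite -(fsbig_card_fibers g (fun ij => (0 < ij.1)%N && (0 < ij.2)%N) F).
  apply: eq_fsbigr => -[i j] _ /=.
  rewrite path_idealE // betti_taylor; last first.
    by move=> w L; apply: path_monomial_minimal.
  rewrite -mulrA; congr (_%:R * _); apply: eq_card => L.
  by rewrite !inE mdeg_path_lcm xpair_eqE.
rewrite /path_set_gf [in RHS](bigD1 finset.set0) //= prefixes0 finset.set0D !cards0 !expr0 mulr1.
rewrite [1 + _]addrC addrK; apply: eq_bigl => L.
by rewrite prefixes_gt0 // card_gt0 andbb.
Qed.

Theorem theorem3p5 (K : fieldType) (k n : nat)
    (k_ge1 : (1 <= k)%N) (n_ge2 : (2 <= n)%N) :
  betti_gf K k n = (1 + var_t * betti_gf K k n.-1) ^+ k - 1.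
Proof.
case: n n_ge2 => // n n_ge1.
by rewrite /= !betti_gfE // path_set_gf_rec.
Qed.
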